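(* Let $\mathcal{R}$ and $\mathcal{R}'$ be TRSs with $\mathcal{R}\stackrel{*}{\leadsto}\mathcal{R}'$ (a rule reversing transformation). Then $\mathcal{R}$ has UNC if and only if $\mathcal{R}'$ has UNC.
   Context: A TRS is a finite set of rewrite rules $l\to r$ ($l\notin\mathcal{V}$, $\mathcal{V}(r)\subseteq\mathcal{V}(l)$); $\mathrm{NF}(\mathcal{R})$ is the set of normal forms; $\mathcal{R}$ has UNC if any two normal forms convertible by $\stackrel{*}{\leftrightarrow}_{\mathcal{R}}$ are equal. For TRSs, $\mathcal{R}\leadsto\mathcal{R}'$ holds if either (1) $\mathcal{R}'=(\mathcal{R}\setminus\{l\to r\})\cup\{l\to l,\ r\to l\}$ for some $l\to r\in\mathcal{R}$ such that $r\notin\mathrm{NF}(\mathcal{R})$ and $r\to l$ is a rewrite rule (i.e. $r\notin\mathcal{V}$ and $\mathcal{V}(l)\subseteq\mathcal{V}(r)$), or (2) $\mathcal{R}'=\mathcal{R}\setminus\{l\to r\}$ for some $l\to r\in\mathcal{R}$ with $l=r$ and $l\notin\mathrm{NF}(\mathcal{R}\setminus\{l\to r\})$. $\stackrel{*}{\leadsto}$ is the reflexive transitive closure of $\leadsto$. *)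

(* Defs.v *)
From mathcomp Require Import all_boot.
From mathcomp Require Import boolp classical_sets cardinality.
From Stdlib Require Export Relation_Operators.

Set Implicit Arguments.
Unset Strict Implicit.
Unset Printing Implicit Defensive.

Local Open Scope classical_set_scope.

Record signature := Signature { symbol : Type; arity : symbol -> nat }.

Section Rewriting.
Variables (S : signature) (V : Type).

Inductive term :=
| Var of V
| App (f : symbol S) of {ffun 'I_(arity f) -> term}.

Definition is_var (t : term) : bool := if t is Var _ then true else false.

Fixpoint vars (t : term) : set V :=
  match t with
  | Var x => [set x]
  | App f ts => \bigcup_i vars (ts i)
  end.

Fixpoint subst (sigma : V -> term) (t : term) : term :=
  match t with
  | Var x => sigma x
  | App f ts => App [ffun i => subst sigma (ts i)]
  end.

(* [CApp f i ts C] is [f(ts_0, .., C, .., ts_(n-1))] with [C] in position [i];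
   the entry [ts i] is ignored. *)
Inductive context :=
| Hole
| CApp (f : symbol S) of 'I_(arity f) & {ffun 'I_(arity f) -> term} & context.

Fixpoint fill (C : context) (t : term) : term :=
  match C with
  | Hole => t
  | CApp f i ts C' => App [ffun j => if j == i then fill C' t else ts j]
  end.

Definition rule : Type := term * term.

Definition rewrite_rule (lr : rule) : Prop :=
  ~~ is_var lr.1 /\ vars lr.2 `<=` vars lr.1.

Record trs := TRS {
  rules :> set rule;
  rules_finite : finite_set rules;
  rules_rewrite : forall lr, rules lr -> rewrite_rule lr }.

(* The notions below are defined for arbitrary sets of rules so that they apply
   directly to differences such as [R `\ (l, r)]. *)
Definition step (R : set rule) (s t : term) : Prop :=
  exists l r C sigma,
    [/\ R (l, r), s = fill C (subst sigma l) & t = fill C (subst sigma r)].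

Definition NF (R : set rule) : set term := [set t | forall u, ~ step R t u].

Definition conv (R : set rule) : term -> term -> Prop :=
  clos_refl_sym_trans term (step R).

Definition UNC (R : set rule) : Prop :=
  forall s t, NF R s -> NF R t -> conv R s t -> s = t.

Inductive reversal (R R' : trs) : Prop :=
| reversal_flip l r of
    rules R (l, r) & ~ NF R r & rewrite_rule (r, l) &
    rules R' = (R `\ (l, r)) `|` [set (l, l); (r, l)]
| reversal_drop l r of
    rules R (l, r) & l = r & ~ NF (R `\ (l, r)) l &
    rules R' = R `\ (l, r).

Definition reversals : trs -> trs -> Prop := clos_refl_trans trs reversal.

End Rewriting.

(* Main.v *)
(** A single reversal changes neither the set of normal forms nor the
    convertibility relation. Convertibility does not see the orientation of a
    rule, nor a rule [l -> l]. The normal forms agree as soon as every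
    left-hand side of either system is reducible in the other: after a flip,
    [l] is reduced by [l -> l], and [r] (resp. [l], for a dropped [l -> l]) is
    reducible by assumption. *)

Require Import Defs.
From mathcomp Require Import all_boot.
From mathcomp Require Import boolp classical_sets.

Set Implicit Arguments.
Unset Strict Implicit.
Unset Printing Implicit Defensive.

Local Open Scope classical_set_scope.

Section Reversal.
Variables (S : signature) (V : Type).
Implicit Types (s t u l r : term S V) (C : context S V) (R : set (rule S V)).

Lemma subst_comp (sigma tau : V -> term S V) t :
  subst tau (subst sigma t) = subst (fun x => subst tau (sigma x)) t.
Proof.
(* The arguments of [App] sit inside a finite function, so the induction over subterms is a raw
   [fix]. *)
move: t; fix IH 1 => -[x|f ts] //=.
by congr App; apply/ffunP => i; rewrite !ffunE; apply: IH.
Qed.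

Lemma step_rule R l r : R (l, r) ->
  forall C sigma, step R (fill C (subst sigma l)) (fill C (subst sigma r)).
Proof. by move=> Rlr C sigma; exists l, r, C, sigma. Qed.

Lemma step_fill R C s t : step R s t -> step R (fill C s) (fill C t).
Proof.
move=> st; elim: C => //= f i ts C [l [r [D [sigma [Rlr -> ->]]]]].
by exists l, r, (CApp i ts D), sigma.
Qed.

Lemma step_subst R sigma s t :
  step R s t -> step R (subst sigma s) (subst sigma t).
Proof.
case=> [l [r [C [tau [Rlr -> ->]]]]].
elim: C => [|f i ts C IH] /=.
  by rewrite !subst_comp; exact: (step_rule Rlr (Hole S V)).
(* Substitution also acts on the siblings [ts j] of the hole, so the instantiated context is rebuilt
   layer by layer. *)
have := step_fill (CApp i [ffun j => subst sigma (ts j)] (Hole S V)) IH.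
rewrite /=; congr step; congr App; apply/ffunP => j; rewrite !ffunE;
  by case: eqP.
Qed.

Definition reducible R s : Prop := exists t, step R s t.

Lemma notin_NF R s : ~ NF R s -> reducible R s.
Proof.
move=> nNF.
by apply: contrapT => nred; apply: nNF => t st; apply: nred; exists t.
Qed.

Lemma reducible_instance R C sigma s :
  reducible R s -> reducible R (fill C (subst sigma s)).
Proof.
by case=> t st; exists (fill C (subst sigma t)); apply/step_fill/step_subst.
Qed.

(** Any [R]-redex is an instance of a left-hand side, and reducibility in [R'] passes to instances
    and to surrounding contexts. *)
Lemma NF_sub R R' :
  (forall l r, R (l, r) -> reducible R' l) -> NF R' `<=` NF R.
Proof.
move=> redR s NFs _ [l [r [C [sigma [Rlr sE _]]]]].
have [t] := reducible_instance C sigma (redR _ _ Rlr).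
by rewrite -sE; apply: NFs.
Qed.

Lemma reducible_lhs R l r : R (l, r) -> reducible R l.
Proof.
(* Empty context, with [Var] as the identity substitution. *)
move=> Rlr; exists r, l, r, (Hole S V), (@Var S V).
have substV t : subst (@Var S V) t = t.
  move: t; fix IH 1 => -[x|f ts] //=.
  by congr App; apply/ffunP => i; rewrite ffunE; apply: IH.
by rewrite /= !substV.
Qed.

(** Each [R]-step turns into an [R']-step, a reversed [R']-step or an equality, and a conversion
    absorbs all three. *)
Lemma conv_sub R R' :
  (forall l r, R (l, r) -> [\/ R' (l, r), R' (r, l) | l = r]) ->
  forall s t, conv R s t -> conv R' s t.
Proof.
move=> sub s t; elim=> {s t} [s t|s|s t _ st|s t u _ st _ tu].
- case=> [l [r [C [sigma [/sub[Rlr|Rrl|<-] -> ->]]]]].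
  + exact/rst_step/step_rule.
  + exact/rst_sym/rst_step/step_rule.
  + exact: rst_refl.
- exact: rst_refl.
- exact: rst_sym.
- exact: rst_trans tu.
Qed.

Lemma UNC_eq R R' :
  NF R = NF R' -> (forall s t, conv R s t <-> conv R' s t) ->
  UNC R <-> UNC R'.
Proof.
rewrite /UNC => -> convE.
by split=> unc s t NFs NFt /convE; apply: unc.
Qed.

Lemma reversal_UNC (R R' : trs S V) : reversal R R' -> UNC R <-> UNC R'.
Proof.
case=> l r Rlr.
- move=> /notin_NF redr _ ->; set R1 := _ `|` _.
  have RR1 a b : rules R (a, b) -> (a, b) = (l, r) \/ R1 (a, b).
    by move=> Rab; case: (EM ((a, b) = (l, r))); [left | right; left].
  have R1R a b : R1 (a, b) -> [\/ rules R (a, b), (a, b) = (l, l) | (a, b) = (r, l)].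
    by case=> [[Rab _]|[|]]; [constructor 1 | constructor 2 | constructor 3].
  apply: UNC_eq => [|s t].
    apply/seteqP; split; apply: NF_sub => a b.
      (* In [R], the rule [(l, r)] reduces the left-hand side of [(l, l)], and [redr] that of
         [(r, l)]. *)
      by move=> /R1R[/reducible_lhs|[-> _]|[-> _]] //; apply: reducible_lhs Rlr.
    move=> /RR1[[-> _]|/reducible_lhs//].
    by apply: (@reducible_lhs _ _ l); right; left.
  split; apply: conv_sub => a b.
    by move=> /RR1[[-> ->]|]; [constructor 2; right; right | constructor 1].
  by move=> /R1R[Rab|[-> ->]|[-> ->]]; [constructor 1 | constructor 3
    | constructor 2].
- move=> lr /notin_NF redl ->; set R1 := _ `\ _.
  have RR1 a b : rules R (a, b) -> (a, b) = (l, r) \/ R1 (a, b).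
    by move=> Rab; case: (EM ((a, b) = (l, r))); [left | right].
  apply: UNC_eq => [|s t].
    apply/seteqP; split; apply: NF_sub => a b.
      by case=> /reducible_lhs.
    by move=> /RR1[[-> _]|/reducible_lhs].
  split; apply: conv_sub => a b.
    (* By [lr] the dropped rule relates equal terms, so its steps become reflexivity. *)
    by move=> /RR1[[-> ->]|]; [constructor 3 | constructor 1].
  by case=> Rab _; constructor 1.
Qed.

End Reversal.

Theorem theorem6 (S : signature) (V : Type) (R R' : trs S V) :
  reversals R R' -> (UNC R <-> UNC R').
Proof.
elim=> {R R'} [R R'|R|R R' R'' _ IH1 _ IH2] //; first exact: reversal_UNC.
by rewrite IH1.
Qed.
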